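(* Let $(q,r)=(16,9)$. There is some $z_*\in(11/16,\,3/4)$ at which the alternating factor vanishes: $$B_{z_*}(-1)=\sum_{i=0}^{15}(-1)^i\frac{V_i(z_* )}{F(z_* )^{i/16}}=0 .$$ Consequently $\mathcal{D}_{9,16}(z_* )=0$, and $z_*/16\in(11/256,\,3/64)$ (the corresponding point $t=z_*/16$ of the unscaled fundamental interval $[0,1/16)$).
   Context: For coprime integers $q\ge2$, $1\le r<q$ (here $q=16$, $r=9$), let $c_i = ir \bmod q\in\{0,\dots,q-1\}$ for every integer $i$ (so $c_i$ is $q$-periodic in $i$). Empty products equal $1$. Define $$\mathcal{D}_{r,q}(z)=\det\left[\prod_{m=0}^{j-1}(z+c_{i+m})\right]_{0\le i,j\le q-1},$$ $$V_0(z)=1,\qquad V_i(z)=\prod_{m=0}^{i-1}(z+c_m)\quad(1\le i\le q),\qquad F(z)=V_q(z)=\prod_{a=0}^{q-1}(z+a).$$ For $z>0$, $F(z)^{1/q}$ is the positive $q$-th root, and $B_z(\xi)=\sum_{i=0}^{q-1}V_i(z)F(z)^{-i/q}\xi^i$. The variables are related by $z=qt$, where $t$ is the variable on the Bishop fundamental interval $[0,1/q)$. *)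

(* Defs.v *)
From HB Require Import structures.
From mathcomp Require Import all_boot all_order all_algebra.
From mathcomp Require Import reals exp.
Set Implicit Arguments.
Unset Strict Implicit.
Unset Printing Implicit Defensive.
Import Order.TTheory GRing.Theory Num.Theory.
Local Open Scope ring_scope.

(* Only indices i >= 0 ever occur below, so i ranges over nat. *)
Definition c (r q i : nat) : nat := ((i * r) %% q)%N.

Definition calD (K : comNzRingType) (r q : nat) (z : K) : K :=
  \det (\matrix_(i < q, j < q) \prod_(m < j) (z + (c r q (i + m))%:R)).

Definition V (K : comNzRingType) (r q i : nat) (z : K) : K :=
  \prod_(m < i) (z + (c r q m)%:R).

Definition F (K : comNzRingType) (q : nat) (z : K) : K :=
  \prod_(a < q) (z + a%:R).

Lemma V_eq_F (K : comNzRingType) (r q : nat) (z : K) :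
  coprime q r -> V r q q z = F q z.
Proof.
case: q => [|q] cop; first by rewrite /V /F !big_ord0.
pose h (i : 'I_q.+1) : 'I_q.+1 := inord (c r q.+1 i).
have hE i : h i = c r q.+1 i :> nat by rewrite inordK // ltn_pmod.
have h_inj : injective h.
  move=> i j /(congr1 (@nat_of_ord _)); rewrite !hE /c.
  wlog le_ij : i j / (i <= j)%N => [W|/esym/eqP].
    by case/orP: (leq_total i j) => [/W|/W wji /esym/wji ->].
  rewrite eqn_mod_dvd ?leq_mul2r ?le_ij ?orbT // -mulnBl Gauss_dvdl // => dv.
  apply/val_inj/eqP; rewrite eqn_leq le_ij /=.
  case: (posnP (j - i)) => [/eqP|d_gt0]; first by rewrite subn_eq0.
  have := dvdn_leq d_gt0 dv.
  by rewrite leqNgt (leq_ltn_trans (leq_subr _ _)).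
rewrite /V /F [RHS](reindex_inj h_inj) /=.
by apply: eq_bigr => i _; rewrite -hE.
Qed.

(* Used for z > 0 only, where F q z > 0 and the real power [`^] of it to the
   exponent - i / q is the (- i)-th power of its positive q-th root. *)
Definition B (R : realType) (r q : nat) (z xi : R) : R :=
  \sum_(i < q) V r q i z * (F q z) `^ (- (i%:R / q%:R)) * xi ^+ i.

(* Main.v *)
(* Put w = F(z) ^ (-1/16) and g_n = V_n(z) (- w) ^ n, with V_n extended to all n.
   Since V_(n + 16) = F V_n and (- w) ^ 16 = 1 / F, the sequence g is 16-periodic.
   Row i of the matrix defining D, applied to the vector ((- w) ^ j)_j and
   multiplied by g_i, is the sum of the g_(i + j), a cyclic shift of the sum
   B_z(-1); so B_z(-1) = 0 forces D = 0.  A zero of B_z(-1) exists by the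
   intermediate value theorem, as rational enclosures of w show that it is
   positive at z = 11/16 and negative at z = 3/4. *)
Require Import Defs.
From mathcomp Require Import all_boot all_order all_algebra.
From mathcomp Require Import classical_sets reals topology normedtype.
From mathcomp Require Import derive exp lra.
Import Order.TTheory GRing.Theory Num.Theory.
Import numFieldNormedType.Exports.
Local Open Scope ring_scope.

Lemma periodic_sum_shift (K : zmodType) (q : nat) (g : nat -> K) :
  (forall n, g (q + n)%N = g n) ->
  forall i, \sum_(j < q) g (i + j)%N = \sum_(j < q) g j.
Proof.
move=> per; elim=> [//|i <-].
(* With [g i] added, both sides equal a sum of q + 1 consecutive terms: split off the first term, or
   the last, which is [g i] by periodicity. *)
apply: (addrI (g i)); transitivity (\sum_(j < q.+1) g (i + j)%N).
  rewrite big_ord_recl addn0; congr (_ + _).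
  by apply: eq_bigr => j _; rewrite addnS.
by rewrite big_ord_recr /= (addnC i q) per addrC.
Qed.

(** Here [w] is any q-th root of 1 / F(z) in the field, so a sign can be absorbed into it. *)
Lemma calD_eq0 (K : fieldType) (r q : nat) (z w : K) :
  (0 < q)%N -> coprime q r -> F q z * w ^+ q = 1 ->
  \sum_(i < q) V r q i z * w ^+ i = 0 -> calD r q z = 0.
Proof.
move=> q_gt0 cop Fw sum0; rewrite -(V_eq_F z cop) in Fw.
pose g i := V r q i z * w ^+ i.
have gq : g q = 1 by [].
(* The product on the right is the (i, j) entry of the matrix, so this identity links its rows to
   [g]. *)
have gD i j : g (i + j)%N
    = g i * (\prod_(m < j) (z + (c r q (i + m))%:R) * w ^+ j).
  by rewrite /g /V big_split_ord exprD mulrACA.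
have g_per n : g (q + n)%N = g n.
  rewrite gD gq mul1r /g /V; congr (_ * _); apply: eq_bigr => m _.
  by rewrite /c mulnDl [(q * r)%N]mulnC modnMDl.
(* Each such [g i] is a factor of [g q = 1]. *)
have g_neq0 (i : 'I_q) : g i != 0.
  apply/eqP => gi0; have := gD i (q - i)%N.
  by rewrite gi0 mul0r subnKC 1?ltnW // gq => /eqP; rewrite oner_eq0.
(* [det0P] asks for a row vector killed from the left, hence the transpose. *)
apply/eqP; rewrite /calD -det_tr; apply/det0P.
exists (\row_(j < q) w ^+ j).
  apply/eqP => /rowP/(_ (Ordinal q_gt0))/eqP.
  by rewrite !mxE expr0 oner_eq0.
apply/rowP => i; rewrite !mxE; apply: (mulfI (g_neq0 i)).
rewrite mulr0 mulr_sumr -[RHS]sum0 -[RHS](@periodic_sum_shift _ _ g g_per i).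
by apply: eq_bigr => j _; rewrite !mxE gD [w ^+ j * _]mulrC.
Qed.

(** Even and odd powers get separate variables: for nonnegative coefficients and arguments the sum
    increases in [x] and decreases in [y], so an enclosure of the root bounds it on both sides. *)
Definition altsum {R : pzRingType} (n : nat) (C : nat -> R) (x y : R) : R :=
  \sum_(i < n) C i * (if odd i then - y ^+ i else x ^+ i).

Lemma altsum_diag (R : comPzRingType) (n : nat) (C : nat -> R) (w : R) :
  \sum_(i < n) C i * (- w) ^+ i = altsum n C w w.
Proof.
by apply: eq_bigr => i _; rewrite exprNn -signr_odd; case: odd;
  rewrite ?expr1 ?expr0 ?mulN1r ?mul1r.
Qed.

Lemma ler_altsum (R : realDomainType) (n : nat) (C : nat -> R) (x x' y y' : R) :
  (forall i, 0 <= C i) -> 0 <= x <= x' -> 0 <= y' <= y ->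
  altsum n C x y <= altsum n C x' y'.
Proof.
move=> C0 /andP[x0 xx'] /andP[y0 yy']; apply: ler_sum => i _.
apply: ler_wpM2l => //; case: odd; rewrite ?lerN2.
  by apply: lerXn2r => //; rewrite nnegrE // (le_trans y0).
by apply: lerXn2r => //; rewrite nnegrE // (le_trans x0).
Qed.

Lemma F_gt0 (R : numDomainType) (q : nat) (z : R) : 0 < z -> 0 < F q z.
Proof. by move=> z0; apply: prodr_gt0 => a _; rewrite ltr_wpDr. Qed.

Lemma V_ge0 (R : numDomainType) (r q i : nat) (z : R) :
  0 <= z -> 0 <= V r q i z.
Proof. by move=> z0; apply: prodr_ge0 => m _; rewrite addr_ge0. Qed.

Definition invrootF {R : realType} (q : nat) (z : R) : R :=
  F q z `^ (- q%:R^-1).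

Lemma invrootF_exp (R : realType) (q i : nat) (z : R) :
  invrootF q z ^+ i = F q z `^ (- (i%:R / q%:R)).
Proof. by rewrite -powR_mulrn ?powR_ge0 // -powRrM mulNr mulrC. Qed.

Lemma F_invrootF (R : realType) (q : nat) (z : R) :
  (0 < q)%N -> 0 < z -> F q z * invrootF q z ^+ q = 1.
Proof.
move=> q0 z0; rewrite invrootF_exp divff ?pnatr_eq0 -?lt0n //.
by rewrite powRN powRr1 ?ltW ?F_gt0 // divff // gt_eqF ?F_gt0.
Qed.

(** Since x -> F(z) x^q is increasing on x >= 0 and equals 1 at the root, enclosing the root reduces
    to rational inequalities. *)
Lemma invrootF_bounds (R : realType) (q : nat) (z a b : R) :
  (0 < q)%N -> 0 < z -> 0 <= a -> 0 <= b ->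
  F q z * a ^+ q <= 1 <= F q z * b ^+ q -> a <= invrootF q z <= b.
Proof.
move=> q0 z0 a0 b0; rewrite -(F_invrootF R q z q0 z0) !ler_pM2l ?F_gt0 //.
by rewrite !ler_pXn2r // ?nnegrE ?powR_ge0.
Qed.

Lemma B_N1 (R : realType) (r q : nat) (z : R) :
  B r q z (-1) = altsum q (fun i => V r q i z) (invrootF q z) (invrootF q z).
Proof.
rewrite -altsum_diag; apply: eq_bigr => i _.
by rewrite -invrootF_exp [in RHS]exprNn -mulrA; congr (_ * _); rewrite mulrC.
Qed.

Lemma B_N1_bounds (R : realType) (r q : nat) (z a b : R) :
  (0 < q)%N -> 0 < z -> 0 <= a -> 0 <= b ->
  F q z * a ^+ q <= 1 <= F q z * b ^+ q ->
  altsum q (fun i => V r q i z) a b <= B r q z (-1)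
    <= altsum q (fun i => V r q i z) b a.
Proof.
move=> q0 z0 a0 b0 /(invrootF_bounds R q z a b q0 z0 a0 b0)/andP[aw wb].
have V0 i : 0 <= V r q i z by apply/V_ge0/ltW.
by rewrite B_N1 !ler_altsum ?a0 ?aw ?wb ?powR_ge0.
Qed.

Lemma continuous_V (R : realType) (r q i : nat) : continuous (V r q i : R -> R).
Proof.
have -> : (V r q i : R -> R)
    = horner (\prod_(m < i) ('X + (c r q m)%:R%:P)).
  apply: boolp.funext => z; rewrite horner_prod; apply: eq_bigr => m _.
  by rewrite !hornerE.
exact: continuous_horner.
Qed.

Lemma continuous_F (R : realType) (q : nat) : continuous (F q : R -> R).
Proof.
(* Taking r = 1 makes F an instance of [V], whose continuity is known. *)
have -> : (F q : R -> R) = V 1 q q.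
  by apply: boolp.funext => z; rewrite V_eq_F // coprimen1.
exact: continuous_V.
Qed.

Lemma continuous_B (R : realType) (r q : nat) (xi z : R) :
  0 < z -> {for z, continuous (fun x => B r q x xi)}.
Proof.
move=> z0; have cont_powF (p : R) : {for z, continuous ((@powR R)^~ p \o F q)}.
  apply: continuous_comp; first exact: continuous_F.
  (* The real power is differentiable at positive bases, and F(z) > 0. *)
  apply/differentiable_continuous/derivable1_diffP/derivable_powR.
  by rewrite in_itv /= F_gt0.
apply: cvg_big => [|i _]; first exact: add_continuous.
apply: cvgM; last exact: cvg_cst.
by apply: cvgM; [exact: continuous_V | exact: cont_powF].
Qed.

(* [a] and [b] enclose F ^ (-1/16).  Their decimals are split into small numerals
   because numeral literals expand to unary naturals. *)
Lemma B_left_gt0 (R : realType) : 0 < B 9 16 (11 / 16 : R) (-1).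
Proof.
have z0 : 0 < 11 / 16 :> R by lra.
pose a : R := 158 / 10 ^+ 3 + 1 / 10 ^+ 6.
pose b : R := 158 / 10 ^+ 3 + 2 / 10 ^+ 6.
have a0 : 0 <= a by rewrite /a; lra.
have b0 : 0 <= b by rewrite /b; lra.
have ab : F 16 (11 / 16) * a ^+ 16 <= 1 <= F 16 (11 / 16) * b ^+ 16.
  by rewrite /F !big_ord_recr big_ord0 /= /a /b; lra.
have /andP[+ _] := B_N1_bounds R 9 16 (11 / 16) a b isT z0 a0 b0 ab.
apply: lt_le_trans.
(* Unfolding the arithmetic of [c] turns the residues into numerals, leaving a closed rational
   inequality. *)
by rewrite /altsum /V !(big_ord_recr, big_ord0) /= /c /modn /muln /= /a /b; lra.
Qed.

Lemma B_right_lt0 (R : realType) : B 9 16 (3 / 4 : R) (-1) < 0.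
Proof.
have z0 : 0 < 3 / 4 :> R by lra.
pose a : R := 155 / 10 ^+ 3 + 57 / 10 ^+ 5.
pose b : R := 155 / 10 ^+ 3 + 58 / 10 ^+ 5.
have a0 : 0 <= a by rewrite /a; lra.
have b0 : 0 <= b by rewrite /b; lra.
have ab : F 16 (3 / 4) * a ^+ 16 <= 1 <= F 16 (3 / 4) * b ^+ 16.
  by rewrite /F !big_ord_recr big_ord0 /= /a /b; lra.
have /andP[_ +] := B_N1_bounds R 9 16 (3 / 4) a b isT z0 a0 b0 ab.
move=> /le_lt_trans; apply.
by rewrite /altsum /V !(big_ord_recr, big_ord0) /= /c /modn /muln /= /a /b; lra.
Qed.

Theorem proposition6 (R : realType) :
  exists z : R,
    [/\ 11 / 16 < z < 3 / 4,
        B 9 16 z (-1) =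
          \sum_(i < 16) (-1) ^+ i * (V 9 16 i z / (F 16 z) `^ (i%:R / 16)),
        B 9 16 z (-1) = 0,
        calD 9 16 z = 0 &
        11 / 256 < z / 16 < 3 / 64 /\ 0 <= z / 16 < 16^-1].
Proof.
have B_left := B_left_gt0 R; have B_right := B_right_lt0 R.
have le_lr : 11 / 16 <= 3 / 4 :> R by lra.
have contB :
    {within `[11 / 16, 3 / 4], continuous (fun z : R => B 9 16 z (-1))}%classic.
  apply: continuous_in_subspaceT => z; rewrite inE /= in_itv /= => /andP[lz _].
  by apply: continuous_B; lra.
have [|z] := IVT (v := 0) le_lr contB.
  by rewrite ge_min le_max (ltW B_left) (ltW B_right) orbT.
rewrite in_itv /= => /andP[lz zr] Bz.
(* The intermediate value theorem gives a closed interval; the strict signs at its ends exclude both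
   endpoints. *)
have {}lz : 11 / 16 < z.
  by rewrite lt_neqAle lz andbT; apply: contraTneq B_left => ->;
    rewrite Bz ltxx.
have {}zr : z < 3 / 4.
  by rewrite lt_neqAle zr andbT; apply: contraTneq B_right => <-;
    rewrite Bz ltxx.
have z0 : 0 < z by lra.
exists z; split=> //; [by rewrite lz | | | by split; lra].
- by apply: eq_bigr => i _; rewrite powRN mulrC.
(* The negative root is admissible because 16 is even. *)
- apply: (calD_eq0 R 9 16 z (- invrootF 16 z)) => //.
    by rewrite exprNn -signr_odd expr0 mul1r F_invrootF.
  by move: Bz; rewrite B_N1 -altsum_diag.
Qed.
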